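(* For all $S>0$, for all $\Delta s>0$ (of the form $\Delta s=S/n$), for all $m\in\mathbb{N}$, and for any positive $\Delta t<2$, the global energy error $\Delta(\boldsymbol{u},\boldsymbol{p})=H(\boldsymbol{u}^m,\boldsymbol{p}^m)-H(\boldsymbol{u},\boldsymbol{p})$ of the Cayley splitting after $m$ steps satisfies $$\mathrm{E}_\nu(\Delta)\le\frac12\,\frac{\Delta t^2}{4-\Delta t^2}\,\mathrm{E}_\nu(\|\boldsymbol{p}\|^2),$$ where $\mathrm{E}_\nu$ denotes the expected value over initial conditions $(\boldsymbol{u},\boldsymbol{p})\in\mathbb{R}^{2(n-1)}$ with a given distribution $\nu$.
   Context: Let $S>0$, let $n\ge2$ be an integer and let $\Delta s = S/n$ (spatial step size); $\Delta t>0$ is the time step size. $\boldsymbol{L}$ is the $(n-1)\times(n-1)$ discrete Dirichlet Laplacian: the symmetric tridiagonal matrix with diagonal entries $-2/\Delta s^2$ and entries $1/\Delta s^2$ on the first sub- and superdiagonal. The Hamiltonian is $$H(\boldsymbol{u},\boldsymbol{p})=\tfrac12\|\boldsymbol{p}\|^2-\tfrac12\boldsymbol{u}^{\mathrm T}\boldsymbol{L}\boldsymbol{u}+\tfrac12\|\boldsymbol{u}\|^2,\qquad \boldsymbol{u},\boldsymbol{p}\in\mathbb{R}^{n-1}.$$ With $\boldsymbol{I}$ the identity matrix, define $$\boldsymbol{A} = \begin{bmatrix} \boldsymbol{0} & \boldsymbol{I}\\ \boldsymbol{L} & \boldsymbol{0}\end{bmatrix},\qquad \boldsymbol{B}=\begin{bmatrix}\boldsymbol{0}&\boldsymbol{0}\\-\boldsymbol{I}&\boldsymbol{0}\end{bmatrix},\qquad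 \boldsymbol{C} = \exp\left(\tfrac12 \Delta t\, \boldsymbol{B}\right)\mathrm{cay}(\Delta t\, \boldsymbol{A})\exp\left(\tfrac12 \Delta t\, \boldsymbol{B}\right),$$ where $\mathrm{cay}(\boldsymbol{X})=(\boldsymbol{I}-\frac12\boldsymbol{X})^{-1}(\boldsymbol{I}+\frac12\boldsymbol{X})$ is the Cayley transform and $\exp$ the matrix exponential. The Cayley splitting is the linear map with matrix $\boldsymbol{C}$, and $(\boldsymbol{u}^m,\boldsymbol{p}^m)$ is defined by $\begin{bmatrix}\boldsymbol{u}^m\\ \boldsymbol{p}^m\end{bmatrix}=\boldsymbol{C}^m\begin{bmatrix}\boldsymbol{u}\\ \boldsymbol{p}\end{bmatrix}$. $\|\cdot\|$ is the Euclidean norm. *)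

(* Defs.v *)
From HB Require Import structures.
From mathcomp Require Import all_boot all_order all_algebra.
From mathcomp Require Import all_classical all_reals all_analysis.

Set Implicit Arguments.
Unset Strict Implicit.
Unset Printing Implicit Defensive.

Import Order.TTheory GRing.Theory Num.Theory.
Import numFieldNormedType.Exports.

Local Open Scope classical_set_scope.
Local Open Scope ring_scope.

(* Euclidean norm; the norm `|v| of the library on matrices is the sup norm. *)
Definition enorm (R : realType) (d : nat) (v : 'cV[R]_d) : R :=
  Num.sqrt (\sum_(i < d) v i 0 ^+ 2).

(* The limit is taken in the normed module of matrices. Powers are those of
   the ring 'M[R]_d, which is available for every d, including d = 0. *)
Definition expmx (R : realType) (d : nat) (X : 'M[R]_d) : 'M[R]_d :=
  limn (series (fun k : nat => (k`!%:R)^-1 *: X ^+ k)).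

Definition cay (R : realType) (d : nat) (X : 'M[R]_d) : 'M[R]_d :=
  invmx (1%:M - 2^-1 *: X) *m (1%:M + 2^-1 *: X).

Definition laplacian (R : realType) (d : nat) (ds : R) : 'M[R]_d :=
  \matrix_(i < d, j < d)
    if i == j then - 2 / ds ^+ 2
    else if (i.+1 == j :> nat) || (j.+1 == i :> nat) then 1 / ds ^+ 2
    else 0.

Definition hamiltonian (R : realType) (d : nat) (ds : R) (u p : 'cV[R]_d) : R :=
  2^-1 * enorm p ^+ 2
  - 2^-1 * (u^T *m laplacian d ds *m u) 0 0
  + 2^-1 * enorm u ^+ 2.

Definition matA (R : realType) (d : nat) (ds : R) : 'M[R]_(d + d) :=
  block_mx 0 1%:M (laplacian d ds) 0.

Definition matB (R : realType) (d : nat) : 'M[R]_(d + d) :=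
  block_mx 0 0 (- 1%:M) 0.

Definition cayley_splitting (R : realType) (d : nat) (ds dt : R) :
    'M[R]_(d + d) :=
  expmx ((2^-1 * dt) *: matB R d) *m cay (dt *: matA d ds)
    *m expmx ((2^-1 * dt) *: matB R d).

(* H (u^m, p^m) - H (u, p) for the initial condition x = (u, p). *)
Definition energy_error (R : realType) (d : nat) (ds dt : R) (m : nat)
    (x : 'cV[R]_(d + d)) : R :=
  let xm := cayley_splitting d ds dt ^+ m *m x in
  hamiltonian ds (usubmx xm) (dsubmx xm) - hamiltonian ds (usubmx x) (dsubmx x).

(* Column vectors with the Borel sigma-algebra. *)
Notation borel_cV R d := (g_sigma_algebraType (@open 'cV[R]_d)).

(* Main.v *)
Require Import Defs.
From mathcomp Require Import all_boot all_order all_algebra.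
From mathcomp Require Import all_classical all_reals all_analysis.
From mathcomp Require Import measurable_realfun ring lra.

Import Order.TTheory GRing.Theory Num.Theory.
Import numFieldNormedType.Exports.

Local Open Scope ring_scope.

(** The bound on the expectations holds pointwise, before averaging, because
    the splitting conserves a modified energy whose kinetic part is the true
    one.

    Write [G = L - I], so that [H = (|p|^2 - u . G u) / 2], and [h] for the
    time step. Multiplying the Cayley step by [I - h A / 2], one step of the
    splitting from [(u, p)] to [(u', p')] says, with the intermediate momenta
    [p1 = p - h u / 2] and [p2 = p' + h u' / 2],
      u' - u = h (p1 + p2) / 2   and   p2 - p1 = h L (u + u') / 2.
    Eliminating [p1] and [p2] leaves ([splitting_stepE])
      p' - p = (h/2) G (u' + u)   and   (h/2) (p' + p) = k (u' - u),
    where [k = 1 - h^2 / 4]. Taking the inner product of these relations and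
    using the symmetry of [G], [|p|^2 - k u . G u] is conserved
    ([midpoint_invariant], [modified_energy_step]). As [k] is a scalar, no
    diagonalisation of [L] is involved.

    After [m] steps the potential energy has therefore changed by [1/k] times
    the loss of kinetic energy, and since [k > 0],
      H(u^m, p^m) - H(u, p) = (1/k - 1) (|p|^2 - |p^m|^2) / 2
                            <= (h^2 / (4 - h^2)) |p|^2 / 2.

    The Cayley transform needs [I - h A / 2] to be invertible: a kernel vector
    [(u, p)] satisfies [u = (h^2/4) L u], which forces [u = 0] as [L] is
    negative semidefinite ([laplacian_le0]).

    Finally, monotonicity of the integral with a nonnegative majorant
    ([le_integral_ge0]) holds for every [nu], whether or not the energy error
    is integrable. *)

(** * The Euclidean inner product *)

Definition dotv {R : realType} {d : nat} (u v : 'cV[R]_d) : R :=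
  (u^T *m v) 0 0.

Section InnerProduct.
Context {R : realType} {d : nat}.
Implicit Types (u v w : 'cV[R]_d) (G L : 'M[R]_d).

Lemma dotvDl u v w : dotv (u + v) w = dotv u w + dotv v w.
Proof. by rewrite /dotv linearD mulmxDl mxE. Qed.

Lemma dotvDr u v w : dotv w (u + v) = dotv w u + dotv w v.
Proof. by rewrite /dotv mulmxDr mxE. Qed.

Lemma dotvZl a u w : dotv (a *: u) w = a * dotv u w.
Proof. by rewrite /dotv linearZ /= -scalemxAl mxE. Qed.

Lemma dotvZr a u w : dotv w (a *: u) = a * dotv w u.
Proof. by rewrite /dotv -scalemxAr mxE. Qed.

Lemma dotvNl u w : dotv (- u) w = - dotv u w.
Proof. by rewrite -scaleN1r dotvZl mulN1r. Qed.

Lemma dotvNr u w : dotv w (- u) = - dotv w u.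
Proof. by rewrite -scaleN1r dotvZr mulN1r. Qed.

Lemma dotvC u v : dotv u v = dotv v u.
Proof.
by rewrite /dotv -[in RHS](trmxK u) -trmx_mul [in RHS]mxE.
Qed.

Lemma dotv_sym G u v : G^T = G -> dotv u (G *m v) = dotv v (G *m u).
Proof. by move=> sG; rewrite dotvC /dotv trmx_mul sG mulmxA. Qed.

Lemma dotvv u : dotv u u = \sum_(i < d) u i 0 ^+ 2.
Proof. by rewrite /dotv mxE; apply: eq_bigr => i _; rewrite mxE expr2. Qed.

Lemma dotvv_ge0 u : 0 <= dotv u u.
Proof. by rewrite dotvv sumr_ge0 // => i _; exact: sqr_ge0. Qed.

Lemma dotvv_le0_eq0 u : dotv u u <= 0 -> u = 0.
Proof.
rewrite dotvv => u0; apply/colP => i; rewrite mxE; apply/eqP.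
rewrite -sqrf_eq0 eq_le sqr_ge0 andbT; apply: le_trans u0.
by rewrite (bigD1 i) //= lerDl sumr_ge0 // => j _; exact: sqr_ge0.
Qed.

Lemma enorm_sqr u : enorm u ^+ 2 = dotv u u.
Proof. by rewrite /enorm sqr_sqrtr -dotvv ?dotvv_ge0. Qed.

(** The two relations are paired with each other: the left sides give
    [a (|p'|^2 - |p|^2)] and the right sides, by symmetry of [G], a difference
    of values of the quadratic form of [G]. Moving the factor [a] across the
    pairing avoids a division by [a]. *)
Lemma midpoint_invariant G (a k : R) u p u' p' :
  G^T = G -> p' - p = a *: (G *m (u' + u)) -> a *: (p' + p) = k *: (u' - u) ->
  dotv p' p' - k * dotv u' (G *m u') = dotv p p - k * dotv u (G *m u).
Proof.
move=> sG ep eu.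
have e : dotv (p' + p) (p' - p) = k * dotv (u' - u) (G *m (u' + u)).
  by rewrite ep dotvZr -dotvZl eu dotvZl.
move: e; rewrite mulmxDr !(dotvDl, dotvDr, dotvNl, dotvNr).
by rewrite (dotvC p' p) (dotv_sym G u u' sG) => e; lra.
Qed.

(** By symmetry [2 u . L u] equals
    [2 \sum_i (\sum_j L i j) u_i^2 - \sum_(i, j) L i j (u_i - u_j)^2],
    and the diagonal does not contribute to the last sum. *)
Lemma quadform_le0 L u :
  L^T = L -> (forall i j, i != j -> 0 <= L i j) ->
  (forall i, \sum_j L i j <= 0) -> dotv u (L *m u) <= 0.
Proof.
move=> sL offL rowL.
have Lsym i j : L j i = L i j by rewrite -[in LHS]sL mxE.
have -> : dotv u (L *m u) = \sum_i \sum_j L i j * (u i 0 * u j 0).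
  rewrite /dotv mxE; apply: eq_bigr => i _.
  by rewrite !mxE mulr_sumr; apply: eq_bigr => j _; ring.
pose D := \sum_i \sum_j L i j * (u i 0 - u j 0) ^+ 2.
pose Q := \sum_i \sum_j L i j * u i 0 ^+ 2.
have D0 : 0 <= D.
  apply: sumr_ge0 => i _; apply: sumr_ge0 => j _.
  have [->|ij] := eqVneq i j; first by rewrite subrr expr0n mulr0.
  by rewrite mulr_ge0 ?sqr_ge0 // offL.
have Q0 : Q <= 0.
  apply: sumr_le0 => i _.
  by rewrite -mulr_suml mulr_le0_ge0 ?sqr_ge0.
have Q' : Q = \sum_i \sum_j L i j * u j 0 ^+ 2.
  rewrite exchange_big; apply: eq_bigr => i _; apply: eq_bigr => j _.
  by rewrite Lsym.
have DQ : D = Q + Q - 2 * \sum_i \sum_j L i j * (u i 0 * u j 0).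
  rewrite {2}Q' mulr_sumr -sumrN -!big_split; apply: eq_bigr => i _.
  by rewrite /= mulr_sumr -sumrN -!big_split; apply: eq_bigr => j _ /=; ring.
by lra.
Qed.

End InnerProduct.

(** * The discrete Laplacian *)

(** Writing the entries with indicators turns the row sums into sums of
    indicators, with no case distinction on the boundary rows. *)
Lemma laplacianE (R : realType) d (ds : R) (i j : 'I_d) :
  laplacian d ds i j = (ds ^+ 2)^-1 *
    ((j == i.+1 :> nat)%:R + (j.+1 == i :> nat)%:R - 2 * (j == i)%:R).
Proof.
rewrite mxE (eq_sym j i) (eq_sym (j : nat)); case: eqVneq => [->|_].
  by rewrite !gtn_eqF ?ltn_eqF //=; ring.
have [<-|_] := eqVneq i.+1 (j : nat); last by case: eqP => _ /=; ring.
by rewrite (gtn_eqF (leqW (leqnn i.+1))) /=; ring.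
Qed.

Lemma sum_indicator_le1 (R : realType) (d k : nat) (f : 'I_d -> nat) :
  injective f -> \sum_j (f j == k)%:R <= 1 :> R.
Proof.
move=> injf; have [/existsP[j0 /eqP fj0]|/existsPn no] :=
  boolP [exists j, f j == k].
  rewrite (bigD1 j0) //= fj0 eqxx big1 ?addr0 // => j jj0.
  by rewrite -fj0 (inj_eq injf) (negPf jj0).
by rewrite big1 ?ler01 // => j _; rewrite (negPf (no j)).
Qed.

Lemma laplacian_sym (R : realType) d (ds : R) :
  (laplacian d ds)^T = laplacian d ds.
Proof.
apply/matrixP => i j; rewrite mxE !laplacianE (eq_sym i j).
by rewrite (eq_sym (i : nat) j.+1) (eq_sym i.+1); ring.
Qed.

(** Every row has at most two off-diagonal entries [1 / ds^2], against the
    diagonal entry [- 2 / ds^2]. *)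
Lemma laplacian_le0 (R : realType) d (ds : R) (u : 'cV[R]_d) :
  dotv u (laplacian d ds *m u) <= 0.
Proof.
apply: quadform_le0 => [|i j ij|i]; first exact: laplacian_sym.
  rewrite laplacianE [j == i]eq_sym (negPf ij) mulr0 subr0.
  by rewrite mulr_ge0 ?invr_ge0 ?sqr_ge0 // addr_ge0.
under eq_bigr do rewrite laplacianE.
rewrite -mulr_sumr mulr_ge0_le0 ?invr_ge0 ?sqr_ge0 //.
rewrite sumrB big_split /= -mulr_sumr [X in _ - 2 * X](bigD1 i) //= eqxx.
rewrite [X in _ - 2 * (_ + X)]big1 ?addr0; last by move=> j /negPf ->.
have right_neighbour := sum_indicator_le1 R d i.+1 (fun j => j) val_inj.
have succ_inj : injective (fun j : 'I_d => j.+1) by move=> x y [] /val_inj.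
have left_neighbour := sum_indicator_le1 R d i _ succ_inj.
by rewrite mulr1; lra.
Qed.

(** * One step of the splitting *)

(** The partial sums of the exponential series are constant from rank 2 on. *)
Lemma expmx_sqr0 (R : realType) d (X : 'M[R]_d) :
  X *m X = 0 -> expmx X = 1%:M + X.
Proof.
move=> XX; rewrite /expmx; apply: norm_lim_near_cst.
near=> N.
have -> : N = (N - 2).+2 by rewrite -addn2 subnK //; near: N; exists 2.
rewrite /series /= !big_nat_recl //= big1 ?addr0.
  by rewrite expr0 expr1 fact0 factS fact0 muln1 !invr1 !scale1r.
by move=> i _; rewrite 2!exprS mulrA -[X * X]/(X *m X) XX mul0r scaler0.
Unshelve. all: by end_near. Qed.

Lemma expmx_matB_mul (R : realType) d (c : R) (u p : 'cV[R]_d) :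
  expmx (c *: matB R d) *m col_mx u p = col_mx u (p - c *: u).
Proof.
rewrite expmx_sqr0; last first.
  rewrite -scalemxAl -scalemxAr /matB mulmx_block.
  by rewrite !mulmx0 !mul0mx !addr0 block_mx_const !scaler0.
rewrite mulmxDl mul1mx -scalemxAl /matB mul_block_col !mul0mx !addr0.
by rewrite mulNmx mul1mx scale_col_mx scaler0 scalerN add_col_mx addr0.
Qed.

Lemma matA_mul (R : realType) d (ds : R) (u p : 'cV[R]_d) :
  matA d ds *m col_mx u p = col_mx p (laplacian d ds *m u).
Proof. by rewrite /matA mul_block_col !mul0mx mul1mx add0r addr0. Qed.

Lemma cay_mulP (R : realType) d (X : 'M[R]_d) (x : 'cV[R]_d) :
  1%:M - 2^-1 *: X \in unitmx ->
  (1%:M - 2^-1 *: X) *m (cay X *m x) = (1%:M + 2^-1 *: X) *m x.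
Proof. by move=> U; rewrite /cay !mulmxA mulmxV // mul1mx. Qed.

Lemma unitmx_ker0 (F : fieldType) d (X : 'M[F]_d) :
  (forall x : 'cV_d, X *m x = 0 -> x = 0) -> X \in unitmx.
Proof.
move=> kX; rewrite -unitmx_tr -row_free_unit; apply: inj_row_free => v vX.
apply: trmx_inj; rewrite trmx0; apply: kX.
by rewrite -[X]trmxK -trmx_mul vX trmx0.
Qed.

(** A kernel vector [(u, p)] satisfies [u = (h^2 / 4) L u], whence
    [|u|^2 = (h^2 / 4) u . L u <= 0]. *)
Lemma cay_matA_unit (R : realType) d (ds h : R) :
  1%:M - 2^-1 *: (h *: matA d ds) \in unitmx.
Proof.
apply: unitmx_ker0 => x.
rewrite -[x]vsubmxK; set u := usubmx x; set p := dsubmx x.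
rewrite mulmxBl mul1mx -!scalemxAl matA_mul !scale_col_mx opp_col_mx add_col_mx.
move/eqP; rewrite col_mx_eq0 !subr_eq0 => /andP[/eqP eu /eqP ep].
suff u0 : u = 0 by rewrite ep u0 mulmx0 !scaler0 col_mx0.
apply: dotvv_le0_eq0; rewrite {2}eu ep !scalerA !dotvZr.
rewrite mulr_ge0_le0 ?laplacian_le0 //.
by rewrite (_ : _ * _ = (h / 2) ^+ 2) ?sqr_ge0 //; field.
Qed.

(** Eliminating the intermediate momenta: the two kicks shift the Laplacian
    to [L - I] in the momentum update and produce the factor [1 - h^2 / 4] in
    the position update, the same for all modes of [L]. *)
Lemma splitting_stepE (R : realType) d (ds h : R) (u p u' p' : 'cV[R]_d) :
  cayley_splitting d ds h *m col_mx u p = col_mx u' p' ->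
  p' - p = (h / 2) *: ((laplacian d ds - 1%:M) *m (u' + u)) /\
  (h / 2) *: (p' + p) = (1 - h ^+ 2 / 4) *: (u' - u).
Proof.
rewrite /cayley_splitting -2!mulmxA expmx_matB_mul.
set c := 2^-1 * h.
have [v [q vq]] : exists v q,
    cay (h *: matA d ds) *m col_mx u (p - c *: u) = col_mx v q.
  by eexists; eexists; rewrite -[LHS]vsubmxK.
rewrite vq expmx_matB_mul => /eq_col_mx[ev <-]; subst v.
have := cay_mulP _ _ _ (col_mx u (p - c *: u)) (cay_matA_unit R d ds h).
rewrite vq mulmxBl mulmxDl !mul1mx -!scalemxAl !matA_mul !scale_col_mx.
rewrite opp_col_mx !add_col_mx !scalerA -/c => /eq_col_mx[].
rewrite mulmxBl mul1mx mulmxDr.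
set Lu := _ *m u; set Lu' := _ *m u' => eu ep.
have c2 : h / 2 = c by rewrite mulrC.
have c4 : h ^+ 2 / 4 = c ^+ 2 by rewrite /c; field.
rewrite c2 c4.
by split; apply/colP => i; move/colP/(_ i): eu; move/colP/(_ i): ep;
  rewrite !mxE; lra.
Qed.

(** * The modified energy *)

(** Twice [T + k V], where [T] and [V] are the kinetic and potential parts of
    the Hamiltonian and [k = 1 - h^2 / 4]. *)
Definition modified_energy {R : realType} {d : nat} (ds h : R)
    (x : 'cV[R]_(d + d)) : R :=
  dotv (dsubmx x) (dsubmx x)
  - (1 - h ^+ 2 / 4) *
    dotv (usubmx x) ((laplacian d ds - 1%:M) *m usubmx x).

Lemma hamiltonianE (R : realType) d (ds : R) (u p : 'cV[R]_d) :
  hamiltonian ds u p =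
  2^-1 * (dotv p p - dotv u ((laplacian d ds - 1%:M) *m u)).
Proof.
rewrite /hamiltonian !enorm_sqr -mulmxA -/(dotv _ _) mulmxBl mul1mx.
by rewrite dotvDr dotvNr; ring.
Qed.

Lemma modified_energy_step (R : realType) d (ds h : R) (x : 'cV[R]_(d + d)) :
  modified_energy ds h (cayley_splitting d ds h *m x) =
  modified_energy ds h x.
Proof.
set y := cayley_splitting d ds h *m x.
have [|ep eu] := splitting_stepE R d ds h (usubmx x) (dsubmx x)
  (usubmx y) (dsubmx y); first by rewrite !vsubmxK.
apply: midpoint_invariant ep eu.
by rewrite linearB /= laplacian_sym trmx1.
Qed.

Lemma modified_energy_iter (R : realType) d (ds h : R) m
    (x : 'cV[R]_(d + d)) :
  modified_energy ds h (cayley_splitting d ds h ^+ m *m x) =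
  modified_energy ds h x.
Proof.
elim: m => [|m IH]; first by rewrite expr0 mul1mx.
by rewrite exprS -mulmxA modified_energy_step.
Qed.

(** The right side minus the left side is
    [(h^2 / (4 - h^2)) |p^m|^2 / 2], which is nonnegative. *)
Lemma energy_error_le (R : realType) d (ds h : R) m (x : 'cV[R]_(d + d)) :
  0 < h -> h < 2 ->
  energy_error ds h m x <=
  2^-1 * (h ^+ 2 / (4 - h ^+ 2)) * enorm (dsubmx x) ^+ 2.
Proof.
move=> h0 h2; rewrite /energy_error !hamiltonianE enorm_sqr.
have := modified_energy_iter R d ds h m x; rewrite /modified_energy.
set y := _ *m x.
have Ty0 : 0 <= dotv (dsubmx y) (dsubmx y) by exact: dotvv_ge0.
move: Ty0; set Ty := dotv (dsubmx y) _; set Tx := dotv (dsubmx x) _.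
set Wy := dotv (usubmx y) _; set Wx := dotv (usubmx x) _ => Ty0 inv.
have h4 : h ^+ 2 < 4 by nra.
have h40 : 4 - h ^+ 2 != 0 by rewrite subr_eq0 gt_eqF.
have -> : Wy = Wx + 4 * (Ty - Tx) / (4 - h ^+ 2).
  by apply: (mulIf h40); rewrite mulrDl divfK //; lra.
rewrite -subr_ge0 (_ : _ - _ = 2^-1 * (h ^+ 2 / (4 - h ^+ 2)) * Ty).
  by rewrite !mulr_ge0 ?invr_ge0 ?sqr_ge0 //; lra.
by field.
Qed.

(** * Integration *)

(** The positive part of [f] is below [g], and subtracting the integral of the
    negative part only helps: when both parts have infinite integral, the
    difference is [-oo]. The integral of a nonnegative function is a supremum
    over the simple functions below it, hence monotone. *)
Lemma le_integral_ge0 (d : measure_display) (T : measurableType d)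
    (R : realType) (mu : {measure set T -> \bar R}) (f g : T -> \bar R) :
  (forall x, 0 <= g x)%E -> (forall x, f x <= g x)%E ->
  (\int[mu]_x f x <= \int[mu]_x g x)%E.
Proof.
move=> g0 fg; rewrite integralE.
apply: (@le_trans _ _ (\int[mu]_x (f^\+ x))%E).
  by rewrite -[leRHS]sube0 leeB // integral_ge0.
rewrite !ge0_integralTE //; apply: ereal_sup_le => _ [s sf <-].
by exists s => //= x; apply: (le_trans (sf x)); rewrite funeposE ge_max fg g0.
Qed.

Lemma continuous_borel_measurable (R : realType) (d : nat)
    (f : 'cV[R]_d -> R) :
  continuous f -> measurable_fun (T := borel_cV R d) setT f.
Proof.
move=> /continuousP cf; apply: (measurability _ (RGenOpens.measurableE R)).
move=> _ [_ [a [b ->] <-]]; rewrite setTI; apply: sub_sigma_algebra.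
exact/cf/interval_open.
Qed.

Lemma measurable_enorm_sqr_dsubmx (R : realType) (d1 d2 : nat) :
  measurable_fun (T := borel_cV R (d1 + d2)) setT
    (fun x : 'cV[R]_(d1 + d2) => enorm (dsubmx x) ^+ 2).
Proof.
rewrite (_ : (fun _ => _) = fun x : borel_cV R (d1 + d2) =>
    \sum_(i < d2) (x : 'cV[R]_(d1 + d2)) (rshift d1 i) 0 ^+ 2).
  apply: measurable_sum => i; apply: measurable_funX.
  by apply: continuous_borel_measurable; exact: coord_continuous.
apply/funext => x; rewrite enorm_sqr dotvv.
by apply: eq_bigr => i _; rewrite mxE.
Qed.

Theorem proposition3p17 (R : realType) (S : R) (n : nat) (m : nat) (dt : R)
    (nu : probability (borel_cV R (n.-1 + n.-1)) R) :
  0 < S -> (2 <= n)%N -> 0 < dt -> dt < 2 ->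
  ('E_nu[fun x : 'cV[R]_(n.-1 + n.-1) =>
          energy_error (S / n%:R) dt m x]
   <= (2^-1 * (dt ^+ 2 / (4 - dt ^+ 2)))%:E
      * 'E_nu[fun x : 'cV[R]_(n.-1 + n.-1) => (enorm (dsubmx x) ^+ 2)%R])%E.
Proof.
move=> _ _ dt0 dt2; rewrite unlock.
have c0 : 0 <= 2^-1 * (dt ^+ 2 / (4 - dt ^+ 2)).
  by rewrite mulr_ge0 ?invr_ge0 // divr_ge0 ?sqr_ge0 //; nra.
rewrite -ge0_integralZl_EFin //; last 2 first.
- by move=> x _; rewrite lee_fin sqr_ge0.
- by apply/measurable_EFinP; exact: measurable_enorm_sqr_dsubmx.
apply: le_integral_ge0 => x.
  by rewrite -EFinM lee_fin mulr_ge0 ?sqr_ge0.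
by rewrite -EFinM lee_fin; exact: energy_error_le.
Qed.
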